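(* Let $a\ge4$ be an even integer. The subtraction game $\mathcal{S}(1,a,3a)$ is periodic with period $3a+1$ and nim-sequence $\big((01)^{a/2}\,2\big)^2(01)^{a/2-1}\,2$. Moreover, the subtraction set has expansion $\{1,a,2a+1,3a\}^{*(3a+1)}$.
   Context: For a finite set $S$ of positive integers, the subtraction game $\mathcal{S}(S)$ is played on a single pile: two players alternately remove $s\in S$ coins (at most the pile size); the last mover wins. The nim-value is $\mathcal{G}(n)=\operatorname{mex}\{\mathcal{G}(n-s): s\in S, s\le n\}$. Words of single digits are written by juxtaposition, and $x^m$ denotes $m$-fold repetition of the block $x$. ''The game is periodic with period $p$ and nim-sequence $W$'' ($W$ a word of length $p$) means $\mathcal{G}(n+p)=\mathcal{G}(n)$ for all $n\ge0$, $p$ is the least such, and $\mathcal{G}(n)$ is the $((n\bmod p)+1)$-st letter of $W$ for all $n\ge0$. The expansion of $S$ is $S^{ex}=\{s\ge1:\mathcal{G}(n+s)\ne\mathcal{G}(n)\ \forall n\ge0\}$; ''has expansion $T$'' means $S^{ex}=T$. For a set $X$ and $p\ge1$, $X^{*p}=\{x+mp:x\in X,m\ge0\}$. *)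

(* Defs.v *)
From mathcomp Require Import all_boot.
From mathcomp Require Import finmap.
From mathcomp Require Import classical_sets.

Set Implicit Arguments.
Unset Strict Implicit.
Unset Printing Implicit Defensive.

Local Open Scope fset_scope.
Local Open Scope classical_set_scope.
Local Open Scope nat_scope.

Fact mex_exists (s : seq nat) : exists n, n \notin s.
Proof.
exists (\max_(i <- s) i).+1; apply/negP => /(@leq_bigmax_seq _ _ predT id).
by move=> /(_ isT); rewrite ltnn.
Qed.

Definition mex (s : seq nat) : nat := ex_minn (mex_exists s).

Definition nim_step (S : {fset nat}) (n : nat) (v : nat -> nat) : nat :=
  mex [seq v (n - s) | s <- S & 0 < s <= n].

(* nim_table S n = [:: G 0; ...; G (n - 1)].  The elements of S are meant to be
   positive: the test 0 < s in nim_step only makes the recursion well-founded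
   for an arbitrary S. *)
Fixpoint nim_table (S : {fset nat}) (n : nat) : seq nat :=
  if n is n'.+1 then
    let t := nim_table S n' in rcons t (nim_step S n' (nth 0 t))
  else [::].

Definition nim_value (S : {fset nat}) (n : nat) : nat :=
  nth 0 (nim_table S n.+1) n.

Lemma size_nim_table S n : size (nim_table S n) = n.
Proof. by elim: n => //= n IHn; rewrite size_rcons IHn. Qed.

Lemma nth_nim_table S n m : m < n -> nth 0 (nim_table S n) m = nim_value S m.
Proof.
elim: n => // n IHn; rewrite ltnS leq_eqVlt => /predU1P[-> //|lt_mn].
by rewrite /= nth_rcons size_nim_table lt_mn IHn.
Qed.

Lemma nim_valueE (S : {fset nat}) n :
  nim_value S n = mex [seq nim_value S (n - s) | s <- S & 0 < s <= n].
Proof.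
rewrite {1}/nim_value /= nth_rcons size_nim_table ltnn eqxx /nim_step.
congr mex; apply/eq_in_map => s; rewrite mem_filter => /andP[/andP[s0 sn] _].
by rewrite nth_nim_table // ltn_subrL s0 (leq_trans s0 sn).
Qed.

Definition word_pow (x : seq nat) (m : nat) : seq nat := flatten (nseq m x).

Definition is_period (p : nat) (f : nat -> nat) : Prop :=
  0 < p /\ forall n, f (n + p) = f n.

Definition periodic_with (S : {fset nat}) (p : nat) (W : seq nat) : Prop :=
  [/\ size W = p,
      is_period p (nim_value S),
      forall q, is_period q (nim_value S) -> p <= q
    & forall n, nim_value S n = nth 0 W (n %% p)].

Definition expansion (S : {fset nat}) : set nat :=
  [set s | 1 <= s /\ forall n, nim_value S (n + s) <> nim_value S n].

Definition star (X : set nat) (p : nat) : set nat :=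
  [set y | exists x m, X x /\ y = x + m * p].

(* Main.v *)
Require Import Defs.
From mathcomp Require Import all_boot.
From mathcomp Require Import finmap.
From mathcomp Require Import classical_sets.
From mathcomp Require Import zify.

(** In one period the letter 2 stands at a, 2a+1, 3a; elsewhere the letter is
    the parity of the residue, complemented between a and 2a+1.  Adding any of
    1, a, 2a+1, 3a changes the letter, and every smaller letter is reached by a
    move that does not leave the current period, so the word satisfies the mex
    recursion.  The cyclic gaps between consecutive 2's are a+1, a-1, a+1, so no
    shorter shift preserves the set of 2's.  For any other nonzero residue r,
    r or 3a+1 - r has letter 0, which is also the letter at 0 and 3a+1, so r is
    not in the expansion. *)

Lemma mex_eq (s : seq nat) m :
  m \notin s -> (forall k, k < m -> k \in s) -> mex s = m.
Proof.
rewrite /mex; case: ex_minnP => i nis imin nms lt_ms.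
apply/eqP; rewrite eqn_leq imin //= leqNgt.
by apply: contra nis => /lt_ms.
Qed.

(** By strong induction the options of [n] carry their [g] values. The first hypothesis, used at
    [n - s], keeps [g n] out of these values, and the second puts every smaller number among
    them. *)
Lemma nim_value_unique (S : {fset nat}) (g : nat -> nat) :
    (forall n s, s \in S -> 0 < s -> g (n + s) <> g n) ->
    (forall n k, k < g n ->
       exists s, [/\ s \in S, 0 < s, s <= n & g (n - s) = k]) ->
  forall n, nim_value S n = g n.
Proof.
move=> gN gR; elim/ltn_ind => n IHn; rewrite nim_valueE.
have -> : [seq nim_value S (n - s) | s <- S & 0 < s <= n]
        = [seq g (n - s) | s <- S & 0 < s <= n].
  apply/eq_in_map => s; rewrite mem_filter => /andP[/andP[s0 sn] _].
  by rewrite IHn // ltn_subrL s0 (leq_trans s0 sn).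
apply: mex_eq => [|k /gR[s [sS s0 sn <-]]].
  apply/mapP => -[s]; rewrite mem_filter => /andP[/andP[s0 sn] sS] gE.
  by apply: (gN (n - s) s) => //; rewrite subnK.
by apply/mapP; exists s; rewrite // mem_filter s0 sn.
Qed.

Lemma size_word_pow x m : size (word_pow x m) = m * size x.
Proof.
by rewrite /word_pow; elim: m => //= m IHm; rewrite size_cat IHm mulSn.
Qed.

Lemma nth_word_pow01 m i : i < m * 2 -> nth 0 (word_pow [:: 0; 1] m) i = odd i.
Proof.
elim: m i => [|m IHm] [|[|i]] //= lt_im.
by rewrite negbK; apply: IHm; lia.
Qed.

Definition letter (a r : nat) : nat :=
  if [|| r == a, r == 2 * a + 1 | r == 3 * a] then 2
  else if a < r < 2 * a + 1 then ~~ odd r else odd r.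

Definition periodic_letter (a n : nat) : nat := letter a (n %% (3 * a + 1)).

Lemma modn_add_lt p n s :
  s < p -> (n + s) %% p = if n %% p + s < p then n %% p + s else n %% p + s - p.
Proof.
move=> sp; have lt_rp := ltn_pmod n (leq_ltn_trans (leq0n s) sp).
rewrite -modnDml; case: ltnP => [/modn_small //|le_p].
by rewrite -{1}(subnK le_p) modnDr modn_small //; lia.
Qed.

Lemma modn_sub_le p n s : s <= n %% p -> 0 < p -> (n - s) %% p = n %% p - s.
Proof.
move=> sr p0; have lt_rp := ltn_pmod n p0.
by rewrite {1}(divn_eq n p) -addnBA // modnMDl modn_small //; lia.
Qed.

Section Letters.

Variables (a : nat) (a_ge4 : 4 <= a) (a_even : ~~ odd a).

Local Notation p := (3 * a + 1).
Local Notation g := (periodic_letter a).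

(** Stated with binary connectives, which [lia] understands. *)
Lemma letterP r :
  letter a r = 2 /\ (r = a \/ r = 2 * a + 1 \/ r = 3 * a)
  \/ letter a r = ~~ odd r /\ a < r < 2 * a + 1
  \/ letter a r = odd r /\ (r < a \/ 2 * a + 1 < r /\ r <> 3 * a).
Proof. by rewrite /letter; case: ifP => ?; [|case: ifP => ?]; lia. Qed.

Ltac letter_lia :=
  repeat match goal with |- context [letter a ?r] =>
    case: (letterP r) => [[-> ?]|[[-> ?]|[-> ?]]] end;
  lia.

Lemma nth_nim_word r : r < p ->
  nth 0 (word_pow (word_pow [:: 0; 1] (a %/ 2) ++ [:: 2]) 2
      ++ word_pow [:: 0; 1] (a %/ 2 - 1) ++ [:: 2]) r = letter a r.
Proof.
move=> rp; rewrite {1}/word_pow /= cats0 -!catA.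
have nth2 i : i < 1 -> nth 0 [:: 2] i = 2 by case: i.
rewrite !nth_cat !size_word_pow.
have -> : size [:: 0; 1] = 2 by []; have -> : size [:: 2] = 1 by [].
(* Five cuts separate the six blocks. The second alternating block starts at the odd index a+1,
   hence the complemented parity; the third starts at the even index 2a+2. *)
by do 5?[case: ltnP => ?]; rewrite ?nth2 ?nth_word_pow01; letter_lia.
Qed.

(** The value 2a+1 is not a move; it is listed for the expansion, being -a modulo 3a+1, just as 3a
    is -1. *)
Lemma periodic_letter_neq n s :
  s \in [:: 1; a; 2 * a + 1; 3 * a] -> g (n + s) <> g n.
Proof.
rewrite !inE => sE; have sp : s < p by lia.
have p0 : 0 < p by lia.
have := ltn_pmod n p0; rewrite /periodic_letter modn_add_lt //.
by move: (n %% p) => r ?; case: ltnP => ?; letter_lia.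
Qed.

Lemma periodic_letter_reach n k : k < g n ->
  exists s, [/\ s \in [:: 1; a; 3 * a], 0 < s, s <= n & g (n - s) = k].
Proof.
move=> kg; have p0 : 0 < p by lia.
have rn : n %% p <= n := leq_mod n p.
have rp := ltn_pmod n p0.
suff [s [sS s0 sr sk]] : exists s,
    [/\ s \in [:: 1; a; 3 * a], 0 < s, s <= n %% p & letter a (n %% p - s) = k].
  by exists s; split=> //; [lia|rewrite /periodic_letter modn_sub_le].
move: kg rp; rewrite /periodic_letter; move: (n %% p) => r {rn}.
have [k1 kg rp|/eqP kN1 kg rp] := eqVneq (letter a (r - 1)) k.
  by exists 1; rewrite !inE eqxx; split=> //; move: kg; letter_lia.
(* Each 1 is preceded by a 0 and each 2 by a 1, so the move 1 fails only when 0 is sought from a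
   2. *)
have [k0 rE] : k = 0 /\ (r = a \/ r = 2 * a + 1 \/ r = 3 * a).
  by move: kg kN1; letter_lia.
(* The move [a] leads from a and 2a+1 to 0 and a+1, of letter 0, but from 3a to 2a, of letter 1;
   there the move 3a is needed. *)
have [ra|/eqP raN] := eqVneq r (3 * a).
  exists (3 * a); rewrite !inE eqxx !orbT ra subnn k0.
  by split; [by []|lia|by []|letter_lia].
exists a; rewrite !inE eqxx orbT k0.
by split; [by []|lia|lia|letter_lia].
Qed.

Lemma nim_value_letter n : nim_value [fset 1; a; 3 * a]%fset n = g n.
Proof.
have memS s : (s \in [fset 1; a; 3 * a]%fset) = (s \in [:: 1; a; 3 * a]).
  by rewrite !inE -orbA.
apply: nim_value_unique => {}n s.
  rewrite memS => sS _; apply: periodic_letter_neq.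
  by move: sS; rewrite !inE; lia.
by move=> /periodic_letter_reach[t]; rewrite -memS; exists t.
Qed.

Lemma periodic_letter_min q : is_period q g -> p <= q.
Proof.
move=> [q0 gq]; rewrite leqNgt; apply/negP => qp.
have two r : letter a r = 2 <-> r = a \/ r = 2 * a + 1 \/ r = 3 * a.
  by letter_lia.
have twoq r : r = a \/ r = 2 * a + 1 \/ r = 3 * a ->
    (r + q = a \/ r + q = 2 * a + 1 \/ r + q = 3 * a)
    \/ (r + q = p + a \/ r + q = p + (2 * a + 1) \/ r + q = p + 3 * a).
  move=> r2; have rp : r < p by lia.
  have := gq r; rewrite /periodic_letter modn_add_lt // modn_small //.
  by rewrite (proj2 (two r) r2); case: ltnP => ? /two; lia.
(* As 0 < q < p, the 2 at a forces q to be a+1 or 2a, the one at 3a forces a+1 or 2a+2, and the one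
   at 2a+1 forces a-1 or 2a; no value meets all three. *)
by have := twoq (3 * a); have := twoq a; have := twoq (2 * a + 1); lia.
Qed.

Lemma periodic_letter_coincidence r : r < p ->
  r \notin [:: 1; a; 2 * a + 1; 3 * a] -> exists n, g (n + r) = g n.
Proof.
move=> rp; rewrite !inE => rN.
have l0 : letter a 0 = 0 by letter_lia.
have [lr|/eqP lrN] := eqVneq (letter a r) 0.
  by exists 0; rewrite /periodic_letter add0n mod0n modn_small // lr l0.
have r0 : r <> 0 by move=> r0; rewrite r0 l0 in lrN.
(* Since [p] is odd, the reflection of [r] to [p - r] flips parity, while it preserves the
   complemented middle stretch and swaps the outer two. *)
have lpr : letter a (p - r) = 0 by move: lrN; letter_lia.
exists (p - r); rewrite subnK ?(ltnW rp) // /periodic_letter modnn.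
by rewrite modn_small ?lpr ?l0 //; lia.
Qed.

End Letters.

Theorem theorem3p12 (a : nat) (a_ge4 : 4 <= a) (a_even : ~~ odd a) :
  let S := [fset 1; a; 3 * a]%fset in
  periodic_with S (3 * a + 1)
    (word_pow (word_pow [:: 0; 1] (a %/ 2) ++ [:: 2]) 2
      ++ word_pow [:: 0; 1] (a %/ 2 - 1) ++ [:: 2])
  /\ expansion S = star [set 1; a; 2 * a + 1; 3 * a]%classic (3 * a + 1).
Proof.
move=> S; have p0 : 0 < 3 * a + 1 by lia.
have gE := nim_value_letter a a_ge4 a_even.
split.
  split=> [||q [q0 qP]|n].
  - by rewrite !(size_cat, size_word_pow) /=; lia.
  - by split=> // n; rewrite !gE /periodic_letter modnDr.
  - by apply: periodic_letter_min => //; split=> // n; rewrite -!gE.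
  - by rewrite gE nth_nim_word // ltn_pmod.
have gDM s m n : periodic_letter a (n + (s + m * (3 * a + 1)))
                 = periodic_letter a (n + s).
  by rewrite /periodic_letter addnA addnC modnMDl.
apply/seteqP; split=> s /=.
  move=> [s1 sN]; exists (s %% (3 * a + 1)), (s %/ (3 * a + 1)).
  split; last by rewrite addnC -divn_eq.
  have [|/(periodic_letter_coincidence a a_ge4 a_even _ (ltn_pmod s p0))[n gn]] :=
    boolP (s %% (3 * a + 1) \in [:: 1; a; 2 * a + 1; 3 * a]).
    by rewrite !inE => /or4P[] /eqP ->; rewrite /setU /set1 /=; tauto.
  by case: (sN n); rewrite !gE -gn /periodic_letter modnDmr.
move=> [x [m [xX ->]]].
have xS : x \in [:: 1; a; 2 * a + 1; 3 * a].
  by move: xX => /= [[[]|]|] ->; rewrite !inE eqxx ?orbT.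
split=> [|n]; first by move: xS; rewrite !inE; lia.
by rewrite !gE gDM; apply: periodic_letter_neq.
Qed.
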